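(* Let $d,k,m\in\mathbb{N}$, and let $\boldsymbol{\gamma}^S:\mathbb{R}^d\to\mathbb{R}^{m\times m}$ and $\boldsymbol{\gamma}^T:\mathbb{R}^k\to\mathbb{R}^{m\times m}$ be two pseudo cross-variograms. For $i,j=1,\dots,m$, let $\mathcal{L}_{ij}$ be the two-dimensional Laplace transform of a finite, for $i\ne j$ potentially signed, measure $\mu_{ij}$ on $[0,\infty)^2$, i.e. $$\mathcal{L}_{ij}(x,y)=\int_{[0,\infty)^2}\exp(-vx-wy)\,d\mu_{ij}(v,w),\qquad x,y\ge 0.$$ Assume that $\mu_{ij}$ has a density $f_{ij}$ with respect to Lebesgue measure such that the matrix of densities $(f_{ij}(v,w))_{i,j=1,\dots,m}$ is symmetric and positive semi-definite for all $v,w\ge 0$. Then the function $\boldsymbol{C}:\mathbb{R}^d\times\mathbb{R}^k\to\mathbb{R}^{m\times m}$ defined by $$C_{ij}(\boldsymbol{h},\boldsymbol{u})=\mathcal{L}_{ij}\left(\gamma^S_{ij}(\boldsymbol{h}),\gamma^T_{ij}(\boldsymbol{u})\right),\qquad i,j=1,\dots,m,$$ is positive definite.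
   Context: A function $\boldsymbol{C}:\mathbb{R}^D\to\mathbb{R}^{m\times m}$ is called positive definite if the kernel $(\boldsymbol{x},\boldsymbol{y})\mapsto\boldsymbol{C}(\boldsymbol{x}-\boldsymbol{y})$ is positive definite, i.e. $C_{ij}(\boldsymbol{x}-\boldsymbol{y})=C_{ji}(\boldsymbol{y}-\boldsymbol{x})$ for all $\boldsymbol{x},\boldsymbol{y},i,j$, and $\sum_{i,j=1}^n\boldsymbol{a}_i^\top\boldsymbol{C}(\boldsymbol{x}_i-\boldsymbol{x}_j)\boldsymbol{a}_j\ge0$ for all $n\in\mathbb{N}$, $\boldsymbol{x}_1,\dots,\boldsymbol{x}_n\in\mathbb{R}^D$, $\boldsymbol{a}_1,\dots,\boldsymbol{a}_n\in\mathbb{R}^m$. Functions on $\mathbb{R}^d\times\mathbb{R}^k$ are treated as functions on $\mathbb{R}^{d+k}$. A pseudo cross-variogram on $\mathbb{R}^D$ is a function $\boldsymbol{\gamma}:\mathbb{R}^D\to\mathbb{R}^{m\times m}$ of the form $\gamma_{ij}(\boldsymbol{h})=\frac12\mathrm{Var}(Z_i(\boldsymbol{x}+\boldsymbol{h})-Z_j(\boldsymbol{x}))$, where $Z=(Z_1,\dots,Z_m)$ is a real $m$-variate random field on $\mathbb{R}^D$ such that all differences $Z_i(\boldsymbol{x})-Z_j(\boldsymbol{y})$ are square integrable and $\mathrm{Var}(Z_i(\boldsymbol{x}+\boldsymbol{h})-Z_j(\boldsymbol{x}))$ does not depend on $\boldsymbol{x}$. Equivalently (known result): $\gamma_{ii}(\boldsymbol{0})=0$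 for all $i$, $\gamma_{ij}(\boldsymbol{h})=\gamma_{ji}(-\boldsymbol{h})$, and $\sum_{i,j=1}^n\boldsymbol{a}_i^\top\boldsymbol{\gamma}(\boldsymbol{x}_i-\boldsymbol{x}_j)\boldsymbol{a}_j\le0$ for all $n$, $\boldsymbol{x}_i\in\mathbb{R}^D$, $\boldsymbol{a}_i\in\mathbb{R}^m$ such that the sum of all components of all $\boldsymbol{a}_i$ is zero. *)

(* Defs.v *)
From HB Require Import structures.
From mathcomp Require Import all_boot all_order all_algebra.
From mathcomp Require Import all_classical all_reals all_analysis.

Set Implicit Arguments.
Unset Strict Implicit.
Unset Printing Implicit Defensive.

Import Order.TTheory GRing.Theory Num.Theory.
Import numFieldNormedType.Exports.

Local Open Scope classical_set_scope.
Local Open Scope ring_scope.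

Definition positive_semidefinite (R : realType) (m : nat) (A : 'M[R]_m) : Prop :=
  forall a : 'cV[R]_m, 0 <= (a^T *m A *m a) 0 0.

Definition positive_definite_function (R : realType) (D m : nat)
    (C : 'rV[R]_D -> 'M[R]_m) : Prop :=
  (forall (x y : 'rV[R]_D) (i j : 'I_m), C (x - y) i j = C (y - x) j i) /\
  (forall (n : nat) (x : 'I_n -> 'rV[R]_D) (a : 'I_n -> 'cV[R]_m),
     0 <= \sum_(i < n) \sum_(j < n) ((a i)^T *m C (x i - x j) *m a j) 0 0).

(* The variance below is the same for every x: this is the requirement that
   it does not depend on the base point. *)
Definition pseudo_cross_variogram (R : realType) (D m : nat)
    (gamma : 'rV[R]_D -> 'M[R]_m) : Prop :=
  exists (disp : measure_display) (Omega : measurableType disp)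
         (P : probability Omega R) (Z : 'I_m -> 'rV[R]_D -> {RV P >-> R}),
    (forall (i j : 'I_m) (x y : 'rV[R]_D),
       (fun w : Omega => Z i x w - Z j y w) \in Lfun P 2%:E) /\
    (forall (i j : 'I_m) (h x : 'rV[R]_D),
       (gamma h i j)%:E =
       ((2^-1)%:E * 'V_P[fun w : Omega => (Z i (x + h) w - Z j x w)%R])%E).

(* Integral against a finite signed measure: difference of the integrals
   against the two parts of its Jordan decomposition, which do not depend on
   the Hahn decomposition picked here. *)
Definition charge_Rintegral (d : measure_display) (T : measurableType d)
    (R : realType) (mu : {charge set T -> \bar R}) (D : set T) (g : T -> R) : R :=
  let: exist P exN := cid (Hahn_decomposition mu) in
  let: exist N PN := cid exN in
  Rintegral (jordan_pos PN) D g - Rintegral (jordan_neg PN) D g.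

Definition plane (R : realType) := (measurableTypeR R * measurableTypeR R)%type.

Definition lebesgue2 (R : realType) : {measure set (plane R) -> \bar R} :=
  (@lebesgue_measure R \x @lebesgue_measure R)%E.

Definition quadrant (R : realType) : set (plane R) :=
  [set z | 0 <= z.1 :> R /\ 0 <= z.2 :> R].

(* A finite signed measure on the quadrant is represented by a charge on the
   plane of which only the restriction to the quadrant is ever used. *)
Definition quadrant_density (R : realType) (mu : {charge set (plane R) -> \bar R})
    (f : R -> R -> R) : Prop :=
  measurable_fun (@quadrant R) (fun z : plane R => f z.1 z.2) /\
  (forall A : set (plane R), measurable A -> A `<=` @quadrant R ->
     mu A = (\int[@lebesgue2 R]_(z in A) (f z.1 z.2)%:E)%E).

Definition nonnegative_on_quadrant (R : realType)
    (mu : {charge set (plane R) -> \bar R}) : Prop :=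
  forall A : set (plane R), measurable A -> A `<=` @quadrant R -> (0 <= mu A)%E.

Definition laplace2 (R : realType) (mu : {charge set (plane R) -> \bar R})
    (x y : R) : R :=
  charge_Rintegral mu (@quadrant R)
    (fun z : plane R => expR (- (z.1 : R) * x - (z.2 : R) * y)).

Definition on_sum (R : realType) (d k m : nat)
    (C : 'rV[R]_d -> 'rV[R]_k -> 'M[R]_m) (z : 'rV[R]_(d + k)) : 'M[R]_m :=
  C (lsubmx z) (rsubmx z).

(* Main.v *)
(* For fixed (v, w) the integrand sum_pq c_p c_q f_pq(v, w) e^(- v gS_pq - w gT_pq)
   is nonnegative.  Indeed, centring at a base point writes
   gamma_pq = (Var W_p + Var W_q) / 2 - Cov (W_p, W_q), so that e^(- v gamma_pq)
   is a rank-one factor times e^(v Cov (W_p, W_q)).  Multiplying a psd kernel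
   entrywise by a covariance gives the expectation of a nonnegative quadratic
   form, hence a psd kernel; the exponential series extends this to
   e^(v Cov).  Starting from the kernel f and applying this twice gives the
   claim, once the integrals against the charges are rewritten as integrals
   of the densities, the Jordan parts having densities f^+ and f^-. *)
Require Import Defs.
From HB Require Import structures.
From mathcomp Require Import all_boot all_order all_algebra.
From mathcomp Require Import all_classical all_reals all_analysis.
From mathcomp Require Import measurable_realfun ring.

Set Implicit Arguments.
Unset Strict Implicit.
Unset Printing Implicit Defensive.

Import Order.TTheory GRing.Theory Num.Theory.
Import numFieldNormedType.Exports.

Local Open Scope classical_set_scope.
Local Open Scope ring_scope.

(** * Finite sums under the real-valued integral *)

Lemma Rintegral_sum (d : measure_display) (T : measurableType d) (R : realType)
    (mu : {measure set T -> \bar R}) (D : set T) (I : Type) (s : seq I)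
    (F : I -> T -> R) :
  measurable D -> (forall i, mu.-integrable D (EFin \o F i)) ->
  \int[mu]_(x in D) (\sum_(i <- s) F i x) =
  \sum_(i <- s) \int[mu]_(x in D) F i x.
Proof.
move=> mD intF; rewrite /Rintegral.
under eq_integral do rewrite -sumEFin.
rewrite integral_sum// -sum_fine // => i _; apply: integrable_fin_num => //.
exact: intF.
Qed.

Lemma integrable_sumr (d : measure_display) (T : measurableType d) (R : realType)
    (mu : {measure set T -> \bar R}) (D : set T) (I : Type) (s : seq I)
    (F : I -> T -> R) :
  measurable D -> (forall i, mu.-integrable D (EFin \o F i)) ->
  mu.-integrable D (EFin \o (fun x => \sum_(i <- s) F i x)).
Proof.
move=> mD intF; rewrite (_ : _ \o _ = fun x => (\sum_(i <- s) (F i x)%:E)%E).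
  by apply: integrable_sum => // i _; exact: intF.
by apply/funext => x /=; rewrite sumEFin.
Qed.

(** * Positive semidefinite kernels on a finite index set and their entrywise products *)

Definition psd_kernel (R : realType) (I : finType) (K : I -> I -> R) :=
  forall c : I -> R, 0 <= \sum_p \sum_q c p * c q * K p q.

Lemma eq_psd_kernel (R : realType) (I : finType) (K L : I -> I -> R) :
  (forall p q, K p q = L p q) -> psd_kernel K -> psd_kernel L.
Proof.
by move=> KL Kpsd c; rewrite -(eq_bigr _ (fun p _ => eq_bigr _ (fun q _ =>
  congr1 (fun z => c p * c q * z) (KL p q)))).
Qed.

Lemma psd_kernelZ (R : realType) (I : finType) (t : R) (K : I -> I -> R) :
  0 <= t -> psd_kernel K -> psd_kernel (fun p q => t * K p q).
Proof.
move=> t0 Kpsd c.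
under eq_bigr do under eq_bigr do rewrite mulrCA.
under eq_bigr do rewrite -mulr_sumr.
by rewrite -mulr_sumr mulr_ge0.
Qed.

Lemma psd_kernelD (R : realType) (I : finType) (K L : I -> I -> R) :
  psd_kernel K -> psd_kernel L -> psd_kernel (fun p q => K p q + L p q).
Proof.
move=> Kpsd Lpsd c.
under eq_bigr do under eq_bigr do rewrite mulrDr.
under eq_bigr do rewrite big_split.
by rewrite big_split addr_ge0.
Qed.

Lemma psd_kernel_congr (R : realType) (I : finType) (s : I -> R)
    (K : I -> I -> R) :
  psd_kernel K -> psd_kernel (fun p q => s p * s q * K p q).
Proof.
move=> Kpsd c; rewrite (eq_bigr _ (fun p _ => eq_bigr _ (fun q _ =>
  _ : _ = (c p * s p) * (c q * s q) * K p q))) ?Kpsd// => *.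
by rewrite mulrA (mulrACA (c _)).
Qed.

(** For fixed [c] the quadratic form is a finite sum, hence continuous in the entries of the
    kernel. *)
Lemma psd_kernel_cvg (R : realType) (I : finType) (u : nat -> I -> I -> R)
    (K : I -> I -> R) :
  (forall p q, u n p q @[n --> \oo] --> K p q) ->
  (forall n, psd_kernel (u n)) -> psd_kernel K.
Proof.
move=> uK upsd c.
have cu : \sum_p \sum_q c p * c q * u n p q @[n --> \oo] -->
    \sum_p \sum_q c p * c q * K p q.
  by apply: cvg_big => [|p _]; [exact: add_continuous|];
     apply: cvg_big => [|q _]; [exact: add_continuous|exact: cvgMr].
rewrite -(cvg_lim _ cu)//; apply: limr_ge; first by apply/cvg_ex; eexists; exact: cu.
by apply: nearW => n; exact: upsd.
Qed.

(** Phrased as an action on psd kernels, so that powers of [B] come from iterating the action and no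
    factorisation of psd matrices is required. *)
Definition schur_multiplier (R : realType) (I : finType) (B : I -> I -> R) :=
  forall A : I -> I -> R, psd_kernel A -> psd_kernel (fun p q => A p q * B p q).

Lemma schur_multiplierX (R : realType) (I : finType) (B : I -> I -> R) n :
  schur_multiplier B -> schur_multiplier (fun p q => B p q ^+ n).
Proof.
move=> hB; elim: n => [|n IH] A hA.
  by apply: eq_psd_kernel hA => p q; rewrite expr0 mulr1.
by apply: eq_psd_kernel (hB _ (IH _ hA)) => p q; rewrite exprSr mulrA.
Qed.

(** Since [t] is nonnegative, the partial sums of the exponential series are nonnegative
    combinations of powers of [B]; the limit stays psd. *)
Lemma schur_multiplier_expR (R : realType) (I : finType) (t : R)
    (B : I -> I -> R) :
  0 <= t -> schur_multiplier B -> schur_multiplier (fun p q => expR (t * B p q)).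
Proof.
move=> t0 hB A hA.
apply: (@psd_kernel_cvg _ _
  (fun n p q => A p q * series (exp_coeff (t * B p q)) n)) => [p q|].
  by apply: cvgMr; exact: is_cvg_series_exp_coeff.
(* [series _ n] sums the indices below [n], so the base case is the zero kernel. *)
elim=> [c|n IH].
  rewrite big1// => p _; rewrite big1// => q _.
  by rewrite /series/= big_geq// !mulr0.
apply: (eq_psd_kernel _ (psd_kernelD IH (psd_kernelZ (t := t ^+ n / n`!%:R) _
  (schur_multiplierX n hB hA)))) => [p q|]; last by rewrite divr_ge0 ?exprn_ge0.
rewrite seriesSr mulrDr; congr (_ + _).
by rewrite /exp_coeff/= exprMn mulrCA; congr (_ * _); rewrite mulrAC.
Qed.

(** With [W p] the centred [Y p], the form at [c] is the expectation of the quadratic form of [A] at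
    the random coefficients [c p * W p], which is nonnegative at every outcome. *)
Lemma schur_multiplier_covariance (R : realType) (I : finType)
    (disp : measure_display) (T : measurableType disp) (P : probability T R)
    (Y : I -> T -> R) :
  (forall p, Y p \in Lfun P 2%:E) ->
  schur_multiplier (fun p q => fine (covariance P (Y p) (Y q))).
Proof.
move=> Y2 A hA c.
pose W p : T -> R := (Y p \- cst (fine 'E_P[Y p]))%R.
have W2 p : W p \in Lfun P 2%:E.
  by rewrite /W rpredB ?lee1n//= Lfun_cst.
have WW p q : P.-integrable setT (EFin \o (W p \* W q)).
  by apply/Lfun1_integrable; exact: Lfun2_mul_Lfun1.
have covW p q : fine (covariance P (Y p) (Y q)) = \int[P]_x (W p x * W q x).
  by rewrite unlock -[_ * _]/(W p \* W q) unlock.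
have intcq p q : P.-integrable setT
    (EFin \o (fun x => c p * W p x * (c q * W q x) * A p q)).
  have := integrableZl measurableT (c p * c q * A p q) (WW p q).
  by apply: eq_integrable => // x _ /=; rewrite -EFinM; congr (_%:E); ring.
suff -> : \sum_p \sum_q c p * c q * (A p q * fine (covariance P (Y p) (Y q))) =
    \int[P]_x (\sum_p \sum_q (c p * W p x) * (c q * W q x) * A p q).
  by apply: Rintegral_ge0 => x _; exact: hA.
rewrite Rintegral_sum//; last first.
  by move=> p; apply: integrable_sumr => // q; exact: intcq.
apply: eq_bigr => p _; rewrite Rintegral_sum//.
apply: eq_bigr => q _.
transitivity (\int[P]_x (c p * c q * A p q * (W p x * W q x))); last first.
  by apply: eq_Rintegral => x _; ring.
rewrite RintegralZl//; last exact: WW.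
by rewrite covW mulrA.
Qed.

(** * Integration against a measure given by a nonnegative density *)

Section density.
Local Open Scope ereal_scope.
Import HBNNSimple.

Lemma integral_nnsfun_density (d : measure_display) (T : measurableType d)
    (R : realType) (nu la : {measure set T -> \bar R}) (D : set T)
    (h : T -> \bar R) (phi : {nnsfun T >-> R}) :
  measurable D -> measurable_fun D h -> (forall x, D x -> 0 <= h x) ->
  (forall A, measurable A -> A `<=` D -> nu A = \int[la]_(x in A) h x) ->
  \int[nu]_(x in D) (phi x)%:E = \int[la]_(x in D) ((phi x)%:E * h x).
Proof.
move=> mD mh h0 nuE.
(* Splitting over the level sets of [phi] reduces the claim to indicators, where [nuE] applies to
   the part of the level set inside [D]. *)
have phiE x : (phi x)%:E = \sum_(y \in range phi) (y * \1_(phi @^-1` [set y]) x)%:E.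
  by rewrite fimfunE fsumEFin.
have mphi y : measurable_fun D (fun x => (y * \1_(phi @^-1` [set y]) x)%:E).
  by apply: (measurable_comp measurableT) => //; exact: measurable_funM.
under eq_integral do rewrite phiE.
rewrite ge0_integral_fsum//; last by move=> y x Dx; exact: nnfun_muleindic_ge0.
under [RHS]eq_integral => x _.
  rewrite phiE ge0_mule_fsuml => [|y]; last exact: nnfun_muleindic_ge0.
  over.
rewrite ge0_integral_fsum//; last 2 first.
- by move=> y; apply: emeasurable_funM.
- by move=> y x Dx; rewrite mule_ge0 ?h0// nnfun_muleindic_ge0.
apply: eq_fsbigr => y /[!inE] -[t _ yE].
have y0 : (0 <= y)%R by rewrite -yE.
have mpre : measurable (phi @^-1` [set y]) by exact: measurable_sfunP.
under eq_integral do rewrite EFinM.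
rewrite ge0_integralZl_EFin//; last 1 first.
- by apply/measurable_EFinP; exact: measurable_indic.
rewrite integral_indic// nuE//; last exact: measurableI.
rewrite setIC integral_mkcondr -ge0_integralZl_EFin//.
- by apply: eq_integral => x _; rewrite epatch_indic /= EFinM -muleA (muleC (h x)).
- by move=> x Dx; rewrite epatch_indic/= mule_ge0// h0.
- rewrite epatch_indic; apply: emeasurable_funM => //.
  by apply/measurable_EFinP; exact: measurable_indic.
Qed.

(** Monotone convergence on both sides along the same increasing simple functions; multiplying by
    [h] keeps them increasing because [h] is nonnegative on [D]. *)
Lemma ge0_integral_density (d : measure_display) (T : measurableType d)
    (R : realType) (nu la : {measure set T -> \bar R}) (D : set T)
    (h : T -> R) (g : T -> \bar R) :
  measurable D -> measurable_fun D h -> (forall x, D x -> (0 <= h x)%R) ->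
  (forall A, measurable A -> A `<=` D -> nu A = \int[la]_(x in A) (h x)%:E) ->
  measurable_fun D g -> (forall x, D x -> 0 <= g x) ->
  \int[nu]_(x in D) g x = \int[la]_(x in D) (g x * (h x)%:E).
Proof.
move=> mD /measurable_EFinP mh h0 nuE mg g0.
pose phi := nnsfun_approx mD mg.
have phig x : D x -> (EFin \o phi n) x @[n --> \oo] --> g x.
  by move=> Dx; exact: cvg_nnsfun_approx.
have mphi n : measurable_fun D (EFin \o phi n).
  by apply/measurable_EFinP; exact: measurable_funTS.
have phind x : {homo (fun n => (phi n x)%:E) : m n / (m <= n)%N >-> m <= n}.
  by move=> m n mn; rewrite lee_fin; exact/lefP/nd_nnsfun_approx.
transitivity (limn (fun n => \int[nu]_(x in D) (phi n x)%:E)).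
  rewrite -monotone_convergence//; last first.
    by move=> n x Dx; rewrite lee_fin.
  by apply: eq_integral => x /[!inE] Dx; apply/esym/cvg_lim => //; exact: phig.
transitivity (limn (fun n => \int[la]_(x in D) ((phi n x)%:E * (h x)%:E))).
  congr (lim (_ @ \oo)); apply/funext => n.
  by apply: integral_nnsfun_density => // x Dx; rewrite lee_fin h0.
rewrite -monotone_convergence//; last 3 first.
- by move=> n; apply: emeasurable_funM => //; exact: mphi.
- by move=> n x Dx; rewrite mule_ge0// lee_fin// h0.
- by move=> x Dx m n mn; rewrite lee_wpmul2r ?lee_fin ?h0// -lee_fin phind.
apply: eq_integral => x /[!inE] Dx; apply/cvg_lim => //.
by apply: cvgeZr => //; exact: phig.
Qed.

End density.

(** * Charges with a density: Jordan parts and integrals *)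

Section charge_density.
Context (d : measure_display) (T : measurableType d) (R : realType).
Context (mu : {charge set T -> \bar R}) (la : {measure set T -> \bar R}).
Context (D : set T) (f : T -> R).
Hypotheses (mD : measurable D) (mf : measurable_fun D f).
Hypothesis muE : forall A, measurable A -> A `<=` D ->
  mu A = (\int[la]_(x in A) (f x)%:E)%E.

Local Open Scope ereal_scope.

Section jordan.
Context (P N : set T) (PN : hahn_decomposition mu P N).

(** The positive set [P] and the set where [f] is nonnegative agree inside [A] up to sets of zero
    charge. *)
Lemma jordan_pos_density A : measurable A -> A `<=` D ->
  jordan_pos PN A = \int[la]_(x in A) (f^\+%R x)%:E.
Proof.
move=> mA AD; have [[mP posP] [mN negN] PNT PN0] := PN.
pose E : set T := D `&` [set x | (0 <= f x)%R].
have mE : measurable E.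
  rewrite /E (_ : [set x | (0 <= f x)%R] = f @^-1` `[0%R, +oo[%classic).
    exact: mf.
  by apply/seteqP; split => x /=; rewrite in_itv/= andbT.
have -> : jordan_pos PN A = mu (A `&` P).
  by rewrite jordan_posE cjordan_posE /crestr0 mem_set.
have mAP := measurableI _ _ mA mP.
have mAE := measurableI _ _ mA mE.
have APD : A `&` P `<=` D by move=> x [/AD].
(* The discarded piece lies in [P], so its charge is at least 0, while [f] is negative on it, so its
   charge is at most 0. *)
have -> : mu (A `&` P) = mu (A `&` E `&` P).
  rewrite (chargeDI mu mAP mE) setIAC.
  suff -> : mu ((A `&` P) `\` E) = 0 by rewrite add0e.
  have mAPE := measurableD mAP mE.
  apply/eqP; rewrite eq_le; apply/andP; split; last first.
    by apply: posP => // x [[]].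
  rewrite muE//; last by move=> x [/APD].
  have f0 x : (A `&` P `\` E) x -> (0 <= - f x)%R.
    move=> [APx nEx]; rewrite oppr_ge0 leNgt; apply/negP => fx.
    by apply: nEx; split; [exact: APD|exact: ltW].
  under eq_integral do rewrite -(opprK (f _)) EFinN.
  rewrite integral_ge0N ?oppe_le0; last by move=> x /f0.
  by apply: integral_ge0 => x /f0.
(* Same squeeze with the roles exchanged: the added piece lies in [N], and [f] is nonnegative on
   it. *)
have -> : mu (A `&` E `&` P) = mu (A `&` E).
  rewrite [RHS](chargeDI mu mAE mP).
  suff -> : mu ((A `&` E) `\` P) = 0 by rewrite add0e.
  have mAEP := measurableD mAE mP.
  apply/eqP; rewrite eq_le; apply/andP; split.
    apply: negN => // x [_ nPx].
    by have : (P `|` N) x by [rewrite PNT]; case.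
  rewrite muE//; last by move=> x [[/AD]].
  by apply: integral_ge0 => x [[_ [_ fx]] _]; rewrite lee_fin.
rewrite muE//; last by move=> x [/AD].
rewrite integral_mkcondr; apply: eq_integral => x /[!inE] Ax.
rewrite patchE; case: ifPn => [/[!inE] -[_ /= fx]|].
  by rewrite /funrpos (max_idPl fx).
rewrite notin_setE => nE; rewrite /funrpos (max_idPr _)//.
by rewrite leNgt; apply/negP => fx; apply: nE; split; [exact: AD|exact: ltW].
Qed.

(** Both the charge and the integral of [f] are a positive minus a negative part; the positive parts
    agree and are finite, so they cancel. *)
Lemma jordan_neg_density A : measurable A -> A `<=` D ->
  jordan_neg PN A = \int[la]_(x in A) (f^\-%R x)%:E.
Proof.
move=> mA AD.
(* The third term may be infinite: the integral of the negative part of [f] is not yet known to be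
   finite. *)
have sub_inj (a b c : \bar R) : a \is a fin_num -> b \is a fin_num ->
    a - b = a - c -> b = c.
  case: a b c => [a| |] [b| |] [c| |]//= _ _.
  by case=> /addrI /oppr_inj ->.
have := muE mA AD.
rewrite (jordan_decomp PN mA) /cadd/= cscaleN1 integralE.
have -> : \int[la]_(x in A) (EFin \o f)^\+ x = jordan_pos PN A.
  by rewrite jordan_pos_density// funerpos.
have : jordan_pos PN A \is a fin_num by exact: fin_num_measure.
have : jordan_neg PN A \is a fin_num by exact: fin_num_measure.
rewrite funerneg => jn jp; exact: sub_inj.
Qed.

End jordan.

(** The integrals of the positive and negative parts of [f] are the masses that the Jordan parts
    give to [D], which are finite. *)
Lemma integrable_charge_density : la.-integrable D (EFin \o f).
Proof.
have [P [N PN]] := Hahn_decomposition mu.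
apply/integrableP; split; first exact/measurable_EFinP.
have posfin : \int[la]_(x in D) (f^\+%R x)%:E < +oo.
  rewrite -(jordan_pos_density PN)// ltey_eq.
  by apply/orP; left; exact: fin_num_measure.
have negfin : \int[la]_(x in D) (f^\-%R x)%:E < +oo.
  rewrite -(jordan_neg_density PN)// ltey_eq.
  by apply/orP; left; exact: fin_num_measure.
have -> : \int[la]_(x in D) `|(EFin \o f) x| =
    \int[la]_(x in D) ((f^\+%R x)%:E + (f^\-%R x)%:E).
  apply: eq_integral => x _; rewrite -EFinD abse_EFin; congr (_%:E).
  by have := congr1 (@^~ x) (funrposDneg f).
rewrite ge0_integralD//; first exact: lte_add_pinfty.
- by move=> x _; rewrite lee_fin funrpos_ge0.
- exact/measurable_EFinP/measurable_funrpos.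
- by move=> x _; rewrite lee_fin funrneg_ge0.
- exact/measurable_EFinP/measurable_funrneg.
Qed.

Context (g : T -> R) (M : R).
Hypotheses (mg : measurable_fun D g) (gM : forall x, D x -> (0 <= g x <= M)%R).

Lemma integrable_bounded_density (h : T -> R) :
  la.-integrable D (EFin \o h) ->
  la.-integrable D (EFin \o (fun x => g x * h x)%R).
Proof.
move=> inth.
have gbnd : [bounded g x | x in D].
  exists M; split; first exact: num_real.
  move=> r Mr x Dx; have /andP[g0 gle] := gM Dx.
  by rewrite /= ger0_norm// (le_trans gle)// ltW.
have := integrableMr mD mg gbnd inth.
by apply: eq_integrable => // x _ /=; rewrite EFinM.
Qed.

(** Nonnegativity of [g] allows the density formula on each Jordan part; its boundedness makes both
    integrals finite, so that they can be subtracted. *)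
Lemma charge_Rintegral_density :
  charge_Rintegral mu D g = (\int[la]_(x in D) (g x * f x))%R.
Proof.
(* The density formulas hold for any Hahn decomposition, hence for the one chosen in the
   definition. *)
rewrite /charge_Rintegral; case: cid => P exN; case: cid => N PN.
have eg x : D x -> 0 <= (g x)%:E by move=> /gM/andP[]; rewrite lee_fin.
have intf := integrable_charge_density.
have -> : (\int[jordan_pos PN]_(x in D) g x = \int[la]_(x in D) (g x * f^\+ x))%R.
  congr fine; rewrite (ge0_integral_density mD (measurable_funrpos mf) _
    (jordan_pos_density PN))//.
  exact/measurable_EFinP.
have -> : (\int[jordan_neg PN]_(x in D) g x = \int[la]_(x in D) (g x * f^\- x))%R.
  congr fine; rewrite (ge0_integral_density mD (measurable_funrneg mf) _
    (jordan_neg_density PN))//.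
  exact/measurable_EFinP.
rewrite -RintegralB//; last 2 first.
- exact/integrable_bounded_density/integrable_funrpos.
- exact/integrable_bounded_density/integrable_funrneg.
apply: eq_Rintegral => x _; rewrite -mulrBr; congr (_ * _)%R.
by have := congr1 (@^~ x) (funrposBneg f).
Qed.

End charge_density.

(** * Pseudo cross-variograms and their exponentials *)

Section variogram.
Context (R : realType) (D m : nat) (gamma : 'rV[R]_D -> 'M[R]_m).
Hypothesis hgamma : pseudo_cross_variogram gamma.

Lemma pseudo_cross_variogram_ge0 h i j : 0 <= gamma h i j.
Proof.
have [disp [Om [P [Z [_ gammaE]]]]] := hgamma.
by rewrite -lee_fin (gammaE i j h 0) mule_ge0// ?variance_ge0// lee_fin invr_ge0.
Qed.

Lemma pseudo_cross_variogram_sym h i j : gamma h i j = gamma (- h) j i.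
Proof.
have [disp [Om [P [Z [Z2 gammaE]]]]] := hgamma.
(* With base points [0] and [h], the two variances are those of opposite variables. *)
apply: EFin_inj; rewrite (gammaE i j h 0) (gammaE j i (- h) h) subrr add0r.
by rewrite -varianceN//; congr (_ * variance P _)%E; apply/funext => w /=;
  rewrite opprB.
Qed.

Lemma schur_multiplier_pseudo_cross_variogram (I : finType)
    (s : I -> 'rV[R]_D) (a : I -> 'I_m) (t : R) :
  0 <= t -> schur_multiplier (fun p q => expR (- t * gamma (s p - s q) (a p) (a q))).
Proof.
move=> t0 A hA.
case: (pickP (@predT I)) => [p0 ? | I0]; last first.
  by move=> c; rewrite big1// => p; have := I0 p.
have [disp [Om [P [Z [Z2 gammaE]]]]] := hgamma.
(* Only differences of the field are assumed square integrable, so the reference variable is the one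
   at an index [p0], which exists once [I] is nonempty. *)
pose W p : Om -> R := (fun w => Z (a p) (s p) w - Z (a p0) (s p0) w).
have W2 p : W p \in Lfun P 2%:E by exact: Z2.
have gE p q : gamma (s p - s q) (a p) (a q) =
    2^-1 * fine 'V_P[W p] + 2^-1 * fine 'V_P[W q] - fine (covariance P (W p) (W q)).
  (* Base point [s q] turns the increment into [W p - W q]. *)
  apply: EFin_inj; rewrite (gammaE _ _ _ (s q)) addrC subrK.
  have -> : (fun w => Z (a p) (s p) w - Z (a q) (s q) w) = (W p \- W q)%R.
    by apply/funext => w /=; rewrite /W opprB addrA subrK.
  rewrite varianceB//.
  have Pfin : P setT \is a fin_num := fin_num_measure P _ measurableT.
  have W1 r := Lfun_subset12 Pfin (W2 r).
  have /fineK <- := variance_fin_num (W2 p).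
  have /fineK <- := variance_fin_num (W2 q).
  have /fineK <- := covariance_fin_num (W1 p) (W1 q) (Lfun2_mul_Lfun1 (W2 p) (W2 q)).
  by congr (_%:E) => /=; field.
pose e p := expR (- t * (2^-1 * fine 'V_P[W p])).
have := psd_kernel_congr e
  (schur_multiplier_expR t0 (schur_multiplier_covariance W2) hA).
apply: eq_psd_kernel => p q.
rewrite gE mulrCA; congr (_ * _); rewrite /e -!expRD; congr expR.
by ring.
Qed.

End variogram.

(** * The quadrant, and matrices as kernels *)

Lemma measurable_quadrant (R : realType) : measurable (@quadrant R).
Proof.
rewrite /quadrant (_ : [set z | _] =
  (fst @^-1` `[0%R, +oo[%classic) `&` (snd @^-1` `[0%R, +oo[%classic)).
  apply: measurableI; rewrite -[X in measurable X]setTI.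
    exact: measurable_fst.
  exact: measurable_snd.
by apply/seteqP; split=> z /=; rewrite !in_itv/= !andbT.
Qed.

Lemma mulmx_bilinear (R : realType) (m : nat) (a b : 'cV[R]_m) (K : 'M[R]_m) :
  (a^T *m K *m b) 0 0 = \sum_p \sum_q a p 0 * b q 0 * K p q.
Proof.
rewrite mxE exchange_big; apply: eq_bigr => q _.
rewrite mxE mulr_suml; apply: eq_bigr => p _.
by rewrite mxE mulrAC.
Qed.

(** The map [s] may repeat indices: adding the coefficients over each fibre gives a vector at which
    [K] has the same quadratic form. *)
Lemma psd_kernel_mx (R : realType) (m : nat) (K : 'M[R]_m) (I : finType)
    (s : I -> 'I_m) :
  positive_semidefinite K -> psd_kernel (fun p q => K (s p) (s q)).
Proof.
move=> Kpsd c.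
pose b : 'cV[R]_m := \col_i \sum_(p | s p == i) c p.
suff -> : \sum_p \sum_q c p * c q * K (s p) (s q) = (b^T *m K *m b) 0 0 by [].
rewrite mulmx_bilinear (partition_big s predT)//=; apply: eq_bigr => i _.
under eq_bigr do rewrite (partition_big s predT)//=.
rewrite exchange_big; apply: eq_bigr => j _ /=.
rewrite !mxE !mulr_suml; apply: eq_bigr => p /eqP sp.
rewrite mulr_sumr mulr_suml; apply: eq_bigr => q /eqP sq.
by rewrite sp sq.
Qed.

(** * Laplace transforms as Lebesgue integrals *)

Section laplace.
Context (R : realType) (mu : {charge set (plane R) -> \bar R}) (f : R -> R -> R).
Hypothesis muf : quadrant_density mu f.
Context (x y : R).
Hypotheses (x0 : 0 <= x) (y0 : 0 <= y).

Let e (z : plane R) : R := expR (- (z.1 : R) * x - (z.2 : R) * y).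

Let me : measurable_fun (@quadrant R) e.
Proof.
apply: measurable_funTS; apply: measurableT_comp => //.
apply: measurable_funB; apply: measurable_funM => //; exact: measurableT_comp.
Qed.

(** On the quadrant the exponent is at most 0, which supplies the bound [M = 1]. *)
Let e01 z : quadrant z -> 0 <= e z <= 1.
Proof.
move=> [z1 z2]; rewrite expR_ge0/= -expR0 ler_expR.
by rewrite mulNr -opprD oppr_le0 addr_ge0// mulr_ge0.
Qed.

Lemma laplace2E :
  laplace2 mu x y = \int[@lebesgue2 R]_(z in @quadrant R)
    (expR (- (z.1 : R) * x - (z.2 : R) * y) * f z.1 z.2).
Proof.
have [mf muE] := muf.
exact: (charge_Rintegral_density (@measurable_quadrant R) mf muE me e01).
Qed.

Lemma integrable_laplace2 : (@lebesgue2 R).-integrable (@quadrant R)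
  (EFin \o (fun z : plane R => expR (- (z.1 : R) * x - (z.2 : R) * y) * f z.1 z.2)).
Proof.
have [mf muE] := muf.
apply: (integrable_bounded_density (@measurable_quadrant R) me e01).
exact: (integrable_charge_density (@measurable_quadrant R) mf muE).
Qed.

End laplace.

Theorem theorem4p1 (R : realType) (d k m : nat)
    (gammaS : 'rV[R]_d -> 'M[R]_m) (gammaT : 'rV[R]_k -> 'M[R]_m)
    (mu : 'I_m -> 'I_m -> {charge set (plane R) -> \bar R})
    (f : R -> R -> 'M[R]_m)
    (hS : pseudo_cross_variogram gammaS)
    (hT : pseudo_cross_variogram gammaT)
    (hmu : forall i : 'I_m, nonnegative_on_quadrant (mu i i))
    (hf : forall i j : 'I_m, quadrant_density (mu i j) (fun v w => f v w i j))
    (hpsd : forall v w : R, 0 <= v -> 0 <= w ->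
       (f v w)^T = f v w /\ positive_semidefinite (f v w)) :
  positive_definite_function
    (on_sum (fun (h : 'rV[R]_d) (u : 'rV[R]_k) =>
       \matrix_(i < m, j < m) laplace2 (mu i j) (gammaS h i j) (gammaT u i j))).
Proof.
split.
  move=> x y i j; rewrite /on_sum !mxE !linearB /=.
  rewrite (pseudo_cross_variogram_sym hS) (pseudo_cross_variogram_sym hT) !opprB.
  rewrite !(laplace2E (hf _ _)) ?(pseudo_cross_variogram_ge0 hS)
    ?(pseudo_cross_variogram_ge0 hT)//.
  (* The exponentials now coincide; what remains is the symmetry of [f] on the quadrant. *)
  apply: eq_Rintegral => z /[!inE] -[z1 z2]; congr (_ * _).
  by have [/matrixP/(_ j i)] := hpsd _ _ z1 z2; rewrite mxE.
move=> n x a.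
(* Indexing by pairs (point, component) turns the block quadratic form into that of one scalar
   kernel. *)
pose I : finType := ('I_n * 'I_m)%type.
pose s (p : I) := lsubmx (x p.1); pose t (p : I) := rsubmx (x p.1).
pose c (p : I) := a p.1 p.2 0.
pose gS (p q : I) := gammaS (s p - s q) p.2 q.2.
pose gT (p q : I) := gammaT (t p - t q) p.2 q.2.
pose e (p q : I) (z : plane R) := expR (- (z.1 : R) * gS p q - (z.2 : R) * gT p q).
have gS0 p q : 0 <= gS p q by exact: pseudo_cross_variogram_ge0 hS _ _ _.
have gT0 p q : 0 <= gT p q by exact: pseudo_cross_variogram_ge0 hT _ _ _.
rewrite (_ : \sum_(i < n) _ = \sum_p \sum_q c p * c q *
    laplace2 (mu p.2 q.2) (gS p q) (gT p q)); last first.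
  rewrite -(pair_bigA _ (fun i l => \sum_q c (i, l) * c q *
    laplace2 (mu l q.2) (gS (i, l) q) (gT (i, l) q)))/=.
  apply: eq_bigr => i _.
  under eq_bigr do rewrite mulmx_bilinear.
  rewrite exchange_big; apply: eq_bigr => l _ /=.
  rewrite -(pair_bigA _ (fun j r => c (i, l) * c (j, r) *
    laplace2 (mu l r) (gS (i, l) (j, r)) (gT (i, l) (j, r))))/=.
  apply: eq_bigr => j _; apply: eq_bigr => r _.
  by rewrite /on_sum !mxE !linearB.
have inte p q : (@lebesgue2 R).-integrable (@quadrant R)
    (EFin \o (fun z : plane R => c p * c q * (e p q z * f z.1 z.2 p.2 q.2))).
  have := integrableZl (@measurable_quadrant R) (c p * c q)
    (integrable_laplace2 (hf p.2 q.2) (gS0 p q) (gT0 p q)).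
  by apply: eq_integrable => //; exact: measurable_quadrant.
(* All entries share the reference measure [lebesgue2], so the form is one integral and pointwise
   nonnegativity suffices. *)
rewrite (_ : \sum_p _ = \int[@lebesgue2 R]_(z in @quadrant R)
    \sum_p \sum_q c p * c q * (e p q z * f z.1 z.2 p.2 q.2)); last first.
  rewrite Rintegral_sum; [|exact: measurable_quadrant|]; last first.
    by move=> p; apply: integrable_sumr => //; exact: measurable_quadrant.
  apply: eq_bigr => p _.
  rewrite Rintegral_sum//; last exact: measurable_quadrant.
  apply: eq_bigr => q _.
  rewrite RintegralZl; [|exact: measurable_quadrant|].
    by rewrite (laplace2E (hf _ _)).
  exact: (integrable_laplace2 (hf p.2 q.2) (gS0 p q) (gT0 p q)).
apply: Rintegral_ge0 => z [z1 z2].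
have [_ fpsd] := hpsd _ _ z1 z2.
suff Epsd : psd_kernel (fun p q => e p q z * f z.1 z.2 p.2 q.2) by exact: Epsd.
(* The matrix [f] at [z], read along components, is multiplied first by the factor of [gammaS], then
   by that of [gammaT]. *)
have := schur_multiplier_pseudo_cross_variogram hT t snd z2
  (schur_multiplier_pseudo_cross_variogram hS s snd z1 (psd_kernel_mx snd fpsd)).
apply: eq_psd_kernel => p q.
by rewrite -mulrA -expRD mulrC /e !mulNr.
Qed.
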